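(* Let $f:T'\to T$ be the morphism of tori given by $$X_1=Y_4Y_5^2,\quad X_2=Y_3,\quad X_3=Y_2,\quad X_4=Y_1.$$ After setting $b_6=a_6/2$, the families $\mathcal{X}^*_{(2,4)}$ and $\mathcal{X}^*_0$ are birationally equivalent via $f$. That is, for each value of the parameter $b_6=a_6/2$, the map $f$ restricts to a birational morphism from the corresponding member of $\mathcal{X}^*_{(2,4)}$ to the corresponding member of $\mathcal{X}^*_0$.
   Context: Work over $\mathbb{C}$. Let $M=\mathbb{Z}^4$ with standard basis $f_1,\dots,f_4$ and $M'=\mathbb{Z}^5$ with standard basis $e_1,\dots,e_5$. Let $T=\mathrm{Spec}\,\mathbb{C}[M]$ and $T'=\mathrm{Spec}\,\mathbb{C}[M']$, with coordinates $X_i=z^{f_i}$ ($1\le i\le4$) and $Y_i=z^{e_i}$ ($1\le i\le5$). The family $\mathcal{X}^*_0$, with parameter $a_6$, is the family of hypersurfaces in $T$ defined by $$-1+X_1+X_2+X_3+X_4+a_5X_1^{-1}(X_2X_3X_4)^{-2}+a_6(X_2X_3X_4)^{-1}=0,\qquad\text{where } 4a_5=a_6^2.$$ The family $\mathcal{X}^*_{(2,4)}$, with parameter $b_6$, is the family of subvarieties of $T'$ defined by $$Y_1+Y_2+Y_3+Y_4=1,\qquad Y_5+b_6(Y_1Y_2Y_3Y_4Y_5)^{-1}=1.$$ A member of a family is the subvariety for a given value of the parameter. A morphism is birational if it restricts to an isomorphism between dense open subsets. *)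

(* Defs.v *)
From HB Require Import structures.
From mathcomp Require Import all_boot all_order all_algebra.
From mathcomp Require Import classical_sets reals complex mpoly.

Set Implicit Arguments.
Unset Strict Implicit.
Unset Printing Implicit Defensive.

Import Order.TTheory GRing.Theory Num.Theory.
Local Open Scope ring_scope.
Local Open Scope classical_set_scope.

(* Varieties over an algebraically closed field K are represented by their
   K-points: a (quasi-affine) variety is a set X of points of affine n-space
   K^n, a point being an n.-tuple K.  All topological notions refer to the
   Zariski topology. *)

Definition zero_locus (K : closedFieldType) (n : nat) (S : set {mpoly K[n]}) :
    set (n.-tuple K) :=
  [set x | forall p, S p -> p.@[tnth x] = 0].

Definition zariski_closed (K : closedFieldType) (n : nat)
    (Z : set (n.-tuple K)) : Prop :=
  exists S : set {mpoly K[n]}, Z = zero_locus S.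

Definition open_in (K : closedFieldType) (n : nat) (X U : set (n.-tuple K)) :
    Prop :=
  exists2 Z, zariski_closed Z & U = X `\` Z.

Definition dense_in (K : closedFieldType) (n : nat) (X U : set (n.-tuple K)) :
    Prop :=
  U `<=` X /\ forall Z, zariski_closed Z -> U `<=` Z -> X `<=` Z.

(* A regular function is a function that is locally a quotient of polynomials;
   the values of h outside X are irrelevant. *)
Definition regular_on (K : closedFieldType) (n : nat) (X : set (n.-tuple K))
    (h : n.-tuple K -> K) : Prop :=
  forall x, X x ->
  exists U (p q : {mpoly K[n]}),
    [/\ open_in X U, U x &
        forall y, U y -> q.@[tnth y] != 0 /\ h y = p.@[tnth y] / q.@[tnth y]].

Definition is_morphism (K : closedFieldType) (n m : nat)
    (X : set (n.-tuple K)) (Y : set (m.-tuple K))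
    (f : n.-tuple K -> m.-tuple K) : Prop :=
  (forall x, X x -> Y (f x)) /\
  (forall j : 'I_m, regular_on X (fun x => tnth (f x) j)).

Definition is_isomorphism (K : closedFieldType) (n m : nat)
    (X : set (n.-tuple K)) (Y : set (m.-tuple K))
    (f : n.-tuple K -> m.-tuple K) : Prop :=
  is_morphism X Y f /\
  exists g : m.-tuple K -> n.-tuple K,
    [/\ is_morphism Y X g,
        forall x, X x -> g (f x) = x &
        forall y, Y y -> f (g y) = y].

Definition is_birational_morphism (K : closedFieldType) (n m : nat)
    (X : set (n.-tuple K)) (Y : set (m.-tuple K))
    (f : n.-tuple K -> m.-tuple K) : Prop :=
  is_morphism X Y f /\
  exists U V,
    [/\ open_in X U /\ dense_in X U,
        open_in Y V /\ dense_in Y V &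
        is_isomorphism U V f].

(* Spec K[Z^n] is the principal open subset of K^n where the product of the
   coordinates does not vanish, so its Zariski topology and its regular
   functions are those induced from K^n. *)
Definition torus (K : closedFieldType) (n : nat) : set (n.-tuple K) :=
  [set x | forall i, tnth x i != 0].

(* Tuples are indexed from 0, so the coordinate X_i is X`_(i-1). *)
Definition member_X0 (K : closedFieldType) (a5 a6 : K) : set (4.-tuple K) :=
  [set X | torus X /\
    let: X1 := X`_0 in let: X2 := X`_1 in
    let: X3 := X`_2 in let: X4 := X`_3 in
    -1 + X1 + X2 + X3 + X4 + a5 * X1^-1 * (X2 * X3 * X4) ^- 2
      + a6 * (X2 * X3 * X4)^-1 = 0].

Definition member_X24 (K : closedFieldType) (b6 : K) : set (5.-tuple K) :=
  [set Y | torus Y /\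
    let: Y1 := Y`_0 in let: Y2 := Y`_1 in let: Y3 := Y`_2 in
    let: Y4 := Y`_3 in let: Y5 := Y`_4 in
    Y1 + Y2 + Y3 + Y4 = 1 /\
    Y5 + b6 * (Y1 * Y2 * Y3 * Y4 * Y5)^-1 = 1].

Definition torus_map (K : closedFieldType) (Y : 5.-tuple K) : 4.-tuple K :=
  let: Y1 := Y`_0 in let: Y2 := Y`_1 in let: Y3 := Y`_2 in
  let: Y4 := Y`_3 in let: Y5 := Y`_4 in
  [tuple Y4 * Y5 ^+ 2; Y3; Y2; Y1].

(* Main.v *)
Require Import Defs.
From HB Require Import structures.
From mathcomp Require Import all_boot all_order all_algebra.
From mathcomp Require Import classical_sets reals complex mpoly.
From mathcomp Require Import ring.

(** Write b = b6, so that a6 = 2 b and a5 = b^2, and put P = X2 X3 X4 and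
    u = 1 - X2 - X3 - X4.  Completing the square turns the equation of the
    hypersurface in T into

      (X1 P + b)^2 = X1 P^2 u                                             (E)

    (X0P).  On the complete intersection in T' the first equation says
    Y4 = u, and the second says b = (1 - Y5) Y5 Y4 P, whence
    X1 P + b = Y5 Y4 P for X1 = Y4 Y5^2.  So Y4 and Y5 are recovered from the
    image point as u and (X1 P + b) / (P u), and (E) is exactly what makes
    these formulas land back in the complete intersection wherever u != 0.
    Hence the map is an isomorphism from the whole complete intersection onto
    the part of the hypersurface where u does not vanish.

    What remains is that this open part is dense (off_branch_dense), that is,
    that the hypersurface has no component inside u = 0.  Solving (E) for X1
    amounts to a double cover of the (X2, X3, X4)-space, and u = 0 is part of
    its branch locus.  Through a given point with u = 0, take the curve in the
    hypersurface on which X3 and X4 are constant.  With x = X2 and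
    z = X1 P + b, it becomes z^2 = g(x) (z - b), where g vanishes at the
    abscissa x0 of the given point.  This relation makes every polynomial
    function on the curve equal to A(x) + B(x) z up to a power of x
    (linear_on_cover_mpoly).  If the function vanishes away from u = 0, so does
    its norm A^2 + A B g + b B^2 g, for infinitely many x; the norm is then the
    zero polynomial, and its value at x0 is A(x0)^2, so A(x0) = 0.  Since
    z = 0 at the given point, the function vanishes there too
    (vanish_at_branch_point). *)

Set Implicit Arguments.
Unset Strict Implicit.
Unset Printing Implicit Defensive.

Import Order.TTheory GRing.Theory Num.Theory.
Local Open Scope ring_scope.
Local Open Scope classical_set_scope.

(** * Regular functions and open sets *)

Section ZariskiBasics.
Variables (K : closedFieldType) (n : nat).
Implicit Types X : set (n.-tuple K).

Lemma open_in_refl X : open_in X X.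
Proof.
exists set0; last by rewrite setD0.
exists [set 1]; apply/seteqP; split => x //= /(_ 1 erefl).
by rewrite meval1 => /eqP; rewrite oner_eq0.
Qed.

Lemma dense_in_refl X : dense_in X X.
Proof. by split. Qed.

Lemma regular_on_quotient X (h : n.-tuple K -> K) (p q : {mpoly K[n]}) :
  (forall x, X x -> q.@[tnth x] != 0 /\ h x = p.@[tnth x] / q.@[tnth x]) ->
  regular_on X h.
Proof. by move=> hX x Xx; exists X, p, q; split=> //; apply: open_in_refl. Qed.

Lemma regular_on_polynomial X (h : n.-tuple K -> K) (p : {mpoly K[n]}) :
  (forall x, X x -> h x = p.@[tnth x]) -> regular_on X h.
Proof.
move=> hX; apply: (@regular_on_quotient _ _ p 1) => x Xx.
by rewrite meval1 oner_neq0 divr1 hX.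
Qed.

End ZariskiBasics.

(** * Functions on a double cover of the line *)

Section DoubleCover.
Variables (K : closedFieldType) (g : {poly K}) (b : K).

Definition on_cover (x z : K) : Prop := z ^+ 2 = g.[x] * (z - b).

Lemma cover_surjective x : exists z, on_cover x z.
Proof.
have [z hz] := @solve_monicpoly K 2
  (fun i => if i == 0%N then - (g.[x] * b) else g.[x]) isT.
exists z; rewrite /on_cover hz !big_ord_recl big_ord0 /= /bump /=; ring.
Qed.

(** The norm of A + B z, the product of its values at the two points above x,
    is a polynomial in x that vanishes outside the roots of E, hence is zero;
    since both points coincide with z = 0 above x0, its value there is the
    square of A.[x0]. *)
Lemma vanish_at_branch_point (A B E : {poly K}) (x0 : K) :
    E != 0 -> g.[x0] = 0 ->
    (forall x z, E.[x] != 0 -> on_cover x z -> A.[x] + B.[x] * z = 0) ->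
  A.[x0] = 0.
Proof.
move=> E0 g0 AB.
pose N := A ^+ 2 + A * B * g + b *: (B ^+ 2 * g).
have /eqP : N * E = 0.
  apply/eqP/negPn/negP => /closed_nonrootP [x]; case/negP.
  rewrite /root hornerM mulf_eq0 orbC.
  have [//|Ex /=] := eqVneq E.[x] 0.
  have [z zx] := cover_surjective x.
  (* The conjugate of z over x is g.[x] - z. *)
  have -> : N.[x] = (A.[x] + B.[x] * z) * (A.[x] + B.[x] * (g.[x] - z)).
    transitivity (A.[x] ^+ 2 + A.[x] * B.[x] * g.[x]
      + B.[x] ^+ 2 * (g.[x] * z - z ^+ 2)); last by ring.
    by rewrite zx !hornerE /=; ring.
  by rewrite AB // mul0r.
rewrite mulf_eq0 (negPf E0) orbF => /eqP /(congr1 (fun p => p.[x0])).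
have -> : N.[x0] = A.[x0] ^+ 2 by rewrite !hornerE /= g0; ring.
by rewrite horner0 => /eqP; rewrite expf_eq0 => /eqP.
Qed.

(** The restriction of p along v lies in the module spanned by 1 and z over the
    Laurent polynomials in x.  Denominators x ^+ k occur because X1 is
    recovered from z by dividing by x. *)
Definition linear_on_cover n (v : K -> K -> 'I_n -> K) (p : {mpoly K[n]}) :=
  exists k (A B : {poly K}), forall x z, x != 0 -> on_cover x z ->
    x ^+ k * p.@[v x z] = A.[x] + B.[x] * z.

Section Closure.
Variables (n : nat) (v : K -> K -> 'I_n -> K).

Lemma linear_on_coverC c : linear_on_cover v c%:MP.
Proof.
exists 0%N, c%:P, 0 => x z _ _; rewrite mevalC !hornerE /=; ring.
Qed.

Lemma linear_on_coverD p q :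
  linear_on_cover v p -> linear_on_cover v q -> linear_on_cover v (p + q).
Proof.
move=> [k [A [B hp]]] [l [C [D hq]]].
exists (k + l)%N, ('X^l * A + 'X^k * C), ('X^l * B + 'X^k * D) => x z x0 xz.
rewrite mevalD !hornerE /= exprD.
transitivity (x ^+ l * (x ^+ k * p.@[v x z]) + x ^+ k * (x ^+ l * q.@[v x z])).
  ring.
rewrite hp // hq //; ring.
Qed.

(** The equation of the cover reduces z^2 to g z - b g, so the module spanned
    by 1 and z is closed under products. *)
Lemma linear_on_coverM p q :
  linear_on_cover v p -> linear_on_cover v q -> linear_on_cover v (p * q).
Proof.
move=> [k [A [B hp]]] [l [C [D hq]]].
exists (k + l)%N, (A * C - b *: (B * D * g)), (A * D + B * C + B * D * g).
move=> x z x0 xz; rewrite mevalM exprD !hornerE /=.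
transitivity ((x ^+ k * p.@[v x z]) * (x ^+ l * q.@[v x z])); first by ring.
rewrite hp // hq //.
transitivity (A.[x] * C.[x] + (A.[x] * D.[x] + B.[x] * C.[x]) * z
  + B.[x] * D.[x] * z ^+ 2); first by ring.
rewrite xz; ring.
Qed.

Lemma linear_on_cover_mpoly :
  (forall i, linear_on_cover v 'X_i) -> forall p, linear_on_cover v p.
Proof.
move=> hX p; rewrite (mpolyE p); apply: big_ind.
- exact: (linear_on_coverC 0).
- exact: linear_on_coverD.
move=> m _; rewrite -mul_mpolyC mpolyXE_id.
apply: linear_on_coverM; first exact: linear_on_coverC.
apply: big_ind.
- exact: (linear_on_coverC 1).
- exact: linear_on_coverM.
move=> i _; elim: (m i) => [|k IH]; first exact: (linear_on_coverC 1).
by rewrite exprS; apply: linear_on_coverM.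
Qed.

End Closure.
End DoubleCover.

(** * Equations of the two families *)

Section Birational.
Variables (K : closedFieldType) (b : K).

(** Completing the square: after multiplication by x1 P^2, the three terms with
    x1, a5 and a6 add up to (x1 P + b)^2. *)
Lemma X0_equationE (x1 x2 x3 x4 : K) :
    x1 != 0 -> x2 != 0 -> x3 != 0 -> x4 != 0 ->
  (-1 + x1 + x2 + x3 + x4 + b ^+ 2 * x1^-1 * (x2 * x3 * x4) ^- 2
      + 2 * b * (x2 * x3 * x4)^-1 = 0) <->
  ((x1 * (x2 * x3 * x4) + b) ^+ 2
     = x1 * (x2 * x3 * x4) ^+ 2 * (1 - x2 - x3 - x4)).
Proof.
move=> n1 n2 n3 n4; set P := x2 * x3 * x4.
have nP : P != 0 by rewrite !mulf_neq0.
have -> : -1 + x1 + x2 + x3 + x4 + b ^+ 2 * x1^-1 * P ^- 2 + 2 * b * P^-1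
  = ((x1 * P + b) ^+ 2 - x1 * P ^+ 2 * (1 - x2 - x3 - x4)) / (x1 * P ^+ 2).
  by field; rewrite n1 nP.
have nD : x1 * P ^+ 2 != 0 by rewrite mulf_neq0 ?expf_neq0.
split=> [/eqP|->]; last by rewrite subrr mul0r.
by rewrite mulf_eq0 invr_eq0 (negPf nD) orbF subr_eq0 => /eqP.
Qed.

Lemma torus4P (x1 x2 x3 x4 : K) :
  torus [tuple x1; x2; x3; x4] <->
  [/\ x1 != 0, x2 != 0, x3 != 0 & x4 != 0].
Proof.
split=> [h|[h1 h2 h3 h4] [[|[|[|[|i]]]] hi] //].
by split; [have := h (@Ordinal 4 0 isT) | have := h (@Ordinal 4 1 isT)
  | have := h (@Ordinal 4 2 isT) | have := h (@Ordinal 4 3 isT)].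
Qed.

Lemma torus5P (x1 x2 x3 x4 x5 : K) :
  torus [tuple x1; x2; x3; x4; x5] <->
  [/\ x1 != 0, x2 != 0, x3 != 0, x4 != 0 & x5 != 0].
Proof.
split=> [h|[h1 h2 h3 h4 h5] [[|[|[|[|[|i]]]]] hi] //].
by split; [have := h (@Ordinal 5 0 isT) | have := h (@Ordinal 5 1 isT)
  | have := h (@Ordinal 5 2 isT) | have := h (@Ordinal 5 3 isT)
  | have := h (@Ordinal 5 4 isT)].
Qed.

Lemma X0P (x1 x2 x3 x4 : K) :
  member_X0 (b ^+ 2) (2 * b) [tuple x1; x2; x3; x4] <->
  [/\ x1 != 0, x2 != 0, x3 != 0 & x4 != 0] /\
  (x1 * (x2 * x3 * x4) + b) ^+ 2
     = x1 * (x2 * x3 * x4) ^+ 2 * (1 - x2 - x3 - x4).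
Proof.
split=> -[].
  move=> /torus4P [n1 n2 n3 n4] /= e; split=> //.
  exact/(X0_equationE n1 n2 n3 n4).
move=> [n1 n2 n3 n4] e; split; first exact/torus4P.
exact/(X0_equationE n1 n2 n3 n4).
Qed.

Lemma X24P (y1 y2 y3 y4 y5 : K) :
  member_X24 b [tuple y1; y2; y3; y4; y5] <->
  [/\ y1 != 0, y2 != 0, y3 != 0, y4 != 0 & y5 != 0] /\
  (y4 = 1 - y3 - y2 - y1 /\
   b = (1 - y5) * y5 * y4 * (y3 * y2 * y1)).
Proof.
have e5 : y1 != 0 -> y2 != 0 -> y3 != 0 -> y4 != 0 -> y5 != 0 ->
    b * (y1 * y2 * y3 * y4 * y5)^-1 = 1 - y5 <->
    b = (1 - y5) * y5 * y4 * (y3 * y2 * y1).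
  move=> n1 n2 n3 n4 n5; have nP : y1 * y2 * y3 * y4 * y5 != 0.
    by rewrite !mulf_neq0.
  split=> [<-|->]; first by field; rewrite n1 n2 n3 n4 n5.
  by field; rewrite n1 n2 n3 n4 n5.
split=> -[t] /= [e f].
  move/torus5P: t => [n1 n2 n3 n4 n5]; do 2?split=> //.
    by rewrite -e; ring.
  by apply/e5 => //; rewrite -f; ring.
case: (t) => n1 n2 n3 n4 n5; split; first exact/torus5P.
rewrite /=; split; first by rewrite e; ring.
by move/e5: f => -> //; ring.
Qed.

(** * The inverse map *)

Definition branch_locus : set (4.-tuple K) :=
  [set X | 1 - X`_1 - X`_2 - X`_3 = 0].

Definition inverse_map (X : 4.-tuple K) : 5.-tuple K :=
  let: X1 := X`_0 in let: X2 := X`_1 in let: X3 := X`_2 in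
  let: X4 := X`_3 in
  let: P := X2 * X3 * X4 in let: u := 1 - X2 - X3 - X4 in
  [tuple X4; X3; X2; u; (X1 * P + b) / (P * u)].

Notation X0 := (member_X0 (b ^+ 2) (2 * b)).

Definition off_branch : set (4.-tuple K) := X0 `\` branch_locus.

Lemma tuple4P (X : 4.-tuple K) :
  exists x1 x2 x3 x4, X = [tuple x1; x2; x3; x4].
Proof.
case: X => -[|x1 [|x2 [|x3 [|x4 [|]]]]] // h.
by exists x1, x2, x3, x4; apply: val_inj.
Qed.

Lemma tuple5P (X : 5.-tuple K) :
  exists x1 x2 x3 x4 x5, X = [tuple x1; x2; x3; x4; x5].
Proof.
case: X => -[|x1 [|x2 [|x3 [|x4 [|x5 [|]]]]]] // h.
by exists x1, x2, x3, x4, x5; apply: val_inj.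
Qed.

Lemma torus_map_off_branch Y : member_X24 b Y -> off_branch (torus_map Y).
Proof.
have [y1 [y2 [y3 [y4 [y5 ->]]]]] := tuple5P Y.
case/X24P => -[n1 n2 n3 n4 n5] [e4 eb]; split.
  apply/X0P; split; first by rewrite !mulf_neq0 // expf_neq0.
  by rewrite /= -e4 eb; ring.
by rewrite /branch_locus /= -e4; apply/eqP.
Qed.

(** By the square form of the equation, x1 P + b and 1 - x2 - x3 - x4 vanish
    together; so the last coordinate of the inverse map stays in the torus. *)
Lemma off_branch_numerator_neq0 (x1 x2 x3 x4 : K) :
    off_branch [tuple x1; x2; x3; x4] -> x1 * (x2 * x3 * x4) + b != 0.
Proof.
case=> /X0P [[n1 n2 n3 n4] e] /eqP /= nu.
by rewrite -sqrf_eq0 e !mulf_neq0.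
Qed.

Lemma inverse_map_in_X24 X : off_branch X -> member_X24 b (inverse_map X).
Proof.
have [x1 [x2 [x3 [x4 ->]]]] := tuple4P X => VX.
have nz := off_branch_numerator_neq0 VX.
case: VX => /X0P [[n1 n2 n3 n4] e] /eqP /= nu; apply/X24P => /=.
split; first by rewrite !mulf_neq0 // invr_eq0 !mulf_neq0.
split=> //; set u := 1 - x2 - x3 - x4 in e nu *.
set P := x2 * x3 * x4 in e nz *.
have nP : P != 0 by rewrite !mulf_neq0.
have -> : (1 - (x1 * P + b) / (P * u)) * ((x1 * P + b) / (P * u)) * u * P
    = (x1 * P + b) - (x1 * P + b) ^+ 2 / (P * u).
  by field; rewrite nP nu.
by rewrite e; field; rewrite nP nu.
Qed.

Lemma torus_mapK Y : member_X24 b Y -> inverse_map (torus_map Y) = Y.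
Proof.
have [y1 [y2 [y3 [y4 [y5 ->]]]]] := tuple5P Y.
case/X24P => -[n1 n2 n3 n4 n5] [e4 eb].
apply: val_inj; rewrite /= -e4; do 4!congr cons.
by congr [:: _]; rewrite [in LHS]eb; field; rewrite n1 n2 n3 n4.
Qed.

Lemma inverse_mapK X : off_branch X -> torus_map (inverse_map X) = X.
Proof.
have [x1 [x2 [x3 [x4 ->]]]] := tuple4P X.
case=> /X0P [[n1 n2 n3 n4] e] /eqP /= nu.
apply: val_inj; rewrite /=; congr cons.
rewrite expr_div_n e; field; rewrite nu /=.
by rewrite n2 n3 n4.
Qed.

Lemma tnth4E (X : 4.-tuple K) i (hi : (i < 4)%N) :
  tnth X (Ordinal hi) = X`_i.
Proof. exact: tnth_nth. Qed.

Notation x_ i := ('X_(@Ordinal 4 i isT) : {mpoly K[4]}).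
Notation y_ i := ('X_(@Ordinal 5 i isT) : {mpoly K[5]}).

Lemma torus_map_morphism : is_morphism (member_X24 b) X0 (@torus_map K).
Proof.
split=> [Y /torus_map_off_branch []//|].
have tn i (hi : (i < 5)%N) (Y : 5.-tuple K) : tnth Y (Ordinal hi) = Y`_i.
  exact: tnth_nth.
case=> [[|[|[|[|j]]]] hj] //.
- apply: (@regular_on_polynomial _ _ _ _ (y_ 3 * y_ 4 ^+ 2)) => Y _.
  by rewrite mevalM rmorphXn /= !mevalXU !tn.
- apply: (@regular_on_polynomial _ _ _ _ (y_ 2)) => Y _.
  by rewrite mevalXU tn.
- apply: (@regular_on_polynomial _ _ _ _ (y_ 1)) => Y _.
  by rewrite mevalXU tn.
- apply: (@regular_on_polynomial _ _ _ _ (y_ 0)) => Y _.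
  by rewrite mevalXU tn.
Qed.

Lemma inverse_map_morphism : is_morphism off_branch (member_X24 b) inverse_map.
Proof.
split=> [X /inverse_map_in_X24 //|].
case=> [[|[|[|[|[|j]]]]] hj] //.
- apply: (@regular_on_polynomial _ _ _ _ (x_ 3)) => Y _.
  by rewrite mevalXU tnth4E.
- apply: (@regular_on_polynomial _ _ _ _ (x_ 2)) => Y _.
  by rewrite mevalXU tnth4E.
- apply: (@regular_on_polynomial _ _ _ _ (x_ 1)) => Y _.
  by rewrite mevalXU tnth4E.
- apply: (@regular_on_polynomial _ _ _ _ (1 - x_ 1 - x_ 2 - x_ 3)) => Y _.
  by rewrite !mevalB meval1 !mevalXU !tnth4E.
- pose P : {mpoly K[4]} := x_ 1 * x_ 2 * x_ 3.
  apply: (@regular_on_quotient _ _ _ _ (x_ 0 * P + b%:MP)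
    (P * (1 - x_ 1 - x_ 2 - x_ 3))) => X.
  rewrite mevalD !mevalM !mevalB meval1 mevalC !mevalXU !tnth4E.
  have [x1 [x2 [x3 [x4 ->]]]] := tuple4P X.
  case=> /X0P [[n1 n2 n3 n4] e] /eqP /= nu.
  by rewrite !mulf_neq0.
Qed.

Lemma branch_locus_closed : zariski_closed branch_locus.
Proof.
exists [set 1 - x_ 1 - x_ 2 - x_ 3]; apply/seteqP; split=> X /=.
  by move=> h _ ->; rewrite !mevalB meval1 !mevalXU !tnth4E.
by move=> /(_ _ erefl); rewrite !mevalB meval1 !mevalXU !tnth4E.
Qed.

(** * Density of the locus where the inverse map is defined *)

Section Slice.
Variables x2 x3 x4 : K.
Hypotheses (n2 : x2 != 0) (n3 : x3 != 0) (n4 : x4 != 0).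
Hypothesis branch : 1 - x2 - x3 - x4 = 0.

(** The curve through (x2, x3, x4) on which the last two coordinates are fixed:
    since x2 + x3 + x4 = 1, 1 - x - x3 - x4 equals x2 - x, so z = X1 P + b satisfies
    z^2 = slice_cover.[x] (z - b). *)
Definition slice_cover : {poly K} := (x3 * x4) *: ('X * (x2%:P - 'X)).

Definition slice_point (x z : K) : 4.-tuple K :=
  [tuple (z - b) / (x * x3 * x4); x; x3; x4].

Lemma horner_slice_cover x : slice_cover.[x] = x3 * x4 * (x * (x2 - x)).
Proof. by rewrite /slice_cover !hornerE /=; ring. Qed.

Lemma slice_point_off_branch x z : b != 0 -> x != 0 -> x != x2 ->
  on_cover slice_cover b x z -> off_branch (slice_point x z).
Proof.
rewrite /on_cover horner_slice_cover => nb nx nx2 xz.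
(* z = b on the curve would give z^2 = 0, hence b = 0. *)
have nzb : z - b != 0.
  apply: contra_neq nb => zb; move: xz; rewrite zb mulr0 => /eqP.
  by rewrite expf_eq0 /= => /eqP z0; move: zb; rewrite z0 sub0r => /eqP;
    rewrite oppr_eq0 => /eqP.
have ux : 1 - x - x3 - x4 = x2 - x.
  by transitivity (1 - x2 - x3 - x4 + x2 - x); [ring | rewrite branch; ring].
split; last by rewrite /branch_locus /= ux; apply/eqP; rewrite subr_eq0 eq_sym.
apply/X0P; split; first by rewrite !mulf_neq0 // invr_eq0 !mulf_neq0.
rewrite ux mulfVK ?mulf_neq0 // subrK xz; field.
by rewrite nx n3 n4.
Qed.

Lemma linear_on_slice p :
  linear_on_cover slice_cover b (fun x z => tnth (slice_point x z)) p.
Proof.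
apply: linear_on_cover_mpoly; case=> [[|[|[|[|j]]]] hj] //.
- exists 1%N, (- (b / (x3 * x4)))%:P, ((x3 * x4)^-1)%:P => x z nx _.
  by rewrite mevalXU tnth4E !hornerE /=; field; rewrite nx n3 n4.
- by exists 0%N, 'X, 0 => x z _ _; rewrite mevalXU tnth4E !hornerE /=; ring.
- by exists 0%N, x3%:P, 0 => x z _ _; rewrite mevalXU tnth4E !hornerE /=; ring.
- by exists 0%N, x4%:P, 0 => x z _ _; rewrite mevalXU tnth4E !hornerE /=; ring.
Qed.

Lemma vanish_at_slice_branch p : b != 0 ->
  (forall X, off_branch X -> p.@[tnth X] = 0) ->
  p.@[tnth (slice_point x2 0)] = 0.
Proof.
move=> nb pV; have [k [A [B hp]]] := linear_on_slice p.
have g0 : slice_cover.[x2] = 0 by rewrite horner_slice_cover subrr !mulr0.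
have /hp : on_cover slice_cover b x2 0 by rewrite /on_cover g0 mul0r expr0n.
rewrite mulr0 addr0 => /(_ n2).
rewrite (@vanish_at_branch_point _ slice_cover b A B ('X * ('X - x2%:P)) x2) //.
- by move/eqP; rewrite mulf_eq0 expf_eq0 (negPf n2) andbF => /eqP.
- by rewrite mulf_neq0 ?polyX_eq0 ?polyXsubC_eq0.
move=> x z; rewrite !hornerE mulf_eq0 negb_or subr_eq0 => /andP [nx nx2] xz.
by rewrite -hp // pV ?mulr0 //; apply: slice_point_off_branch.
Qed.

End Slice.

(** At a point of the branch locus X1 P + b = 0, so b != 0 and the point is the
    one with z = 0 on its slice. *)
Lemma off_branch_dense : dense_in X0 off_branch.
Proof.
split=> [X []//|_ [S ->] VS X X0X].
have [/eqP Xb|Xb] := boolP (1 - X`_1 - X`_2 - X`_3 == 0); last first.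
  by apply: VS; split=> //; apply/eqP.
move=> p Sp; have pV Y : off_branch Y -> p.@[tnth Y] = 0 by move=> /VS; apply.
have [x1 [x2 [x3 [x4 eX]]]] := tuple4P X; subst X.
case/X0P: X0X => -[n1 n2 n3 n4]; rewrite Xb mulr0 => /eqP.
rewrite expf_eq0 /= => /eqP e.
have nb : b != 0.
  apply: contraTneq isT => b0; move/eqP: e.
  by rewrite b0 addr0 !mulf_eq0 (negPf n1) (negPf n2) (negPf n3) (negPf n4).
suff -> : [tuple x1; x2; x3; x4] = slice_point x3 x4 x2 0.
  exact: vanish_at_slice_branch.
apply: val_inj; congr cons; rewrite sub0r.
have -> : - b = x1 * (x2 * x3 * x4) by apply/eqP; rewrite eq_sym -addr_eq0 e.
by rewrite mulfK // !mulf_neq0.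
Qed.

Lemma torus_map_birational :
  is_birational_morphism (member_X24 b) X0 (@torus_map K).
Proof.
split; first exact: torus_map_morphism.
exists (member_X24 b), off_branch; split.
- by split; [apply: open_in_refl | apply: dense_in_refl].
- split; last exact: off_branch_dense.
  by exists branch_locus => //; apply: branch_locus_closed.
split.
  split; first exact: torus_map_off_branch.
  by have [] := torus_map_morphism.
exists inverse_map; split.
- exact: inverse_map_morphism.
- exact: torus_mapK.
- exact: inverse_mapK.
Qed.

End Birational.

Theorem theorem6p1 (R : realType) (a5 a6 b6 : R[i])
    (ha5 : 4 * a5 = a6 ^+ 2) (hb6 : b6 = a6 / 2) :
  is_birational_morphism (member_X24 b6) (member_X0 a5 a6)
    (@torus_map _).
Proof.
have n2 : (2 : R[i]) != 0 by rewrite pnatr_eq0.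
have -> : a6 = 2 * b6 by rewrite hb6 mulrC divfK.
have -> : a5 = b6 ^+ 2.
  have n4 : (4 : R[i]) != 0 by rewrite pnatr_eq0.
  apply: (mulfI n4); rewrite ha5 hb6; by field.
exact: torus_map_birational.
Qed.
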